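(* Let $\gamma \in \mathbb{R}^+$ be given, and suppose that the functions $V_0,\dots,V_{N_f}:\mathbb{R}^M\to\mathbb{R}\cup\{+\infty\}$ satisfy, for all $x=(x_1,\dots,x_M)\in\mathbb{R}^M$, $$V_{N_f}(x) = \frac{p_d}{30}\,\gamma,$$ $$V_{j-1}(x) = \min_{u\in W_{\gamma,j-1}(x)} \Big( p_{j-1}\, g(j-1,u,x_1)\,\Delta t + V_j(f(x,u)) \Big),\qquad j=1,\dots,N_f,$$ where $p_j = p_{\mathrm{off}}$ if $j\in S_{\mathrm{off}}$, $p_j=p_{\mathrm{on}}$ if $j\in S_{\mathrm{on}}$, and $$W_{\gamma,j}(x) = \begin{cases}\{u\in\mathbb{R}: T_{\min}\le u\le T_{\max},\ g(j,u,x_1)\le\gamma\}, & j\in S_{\mathrm{on}},\\ \{u\in\mathbb{R}: T_{\min}\le u\le T_{\max}\}, & j\in S_{\mathrm{off}}.\end{cases}$$ Then $V_0(T^0)=J^*$, where $J^*=J^*(p_{\mathrm{on}},p_{\mathrm{off}},p_d)$ is the optimal value of the problem $$J^* = \min_{u_0,\dots,u_{N_f-1}\in\mathbb{R},\ T^1,\dots,T^{N_f}\in\mathbb{R}^M}\ \Big( p_{\mathrm{off}}\sum_{k\in S_{\mathrm{off}}} g(k,u_k,T^k_1) + p_{\mathrm{on}}\sum_{k\in S_{\mathrm{on}}} g(k,u_k,T^k_1)\Big)\Delta t + \frac{p_d}{30}\,\gamma$$ subject to $$g(k,u_k,T^k_1)\le\gamma \ \text{ for } k\in S_{\mathrm{on}},$$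 $$T^{k+1}=f(T^k,u_k)\ \text{ for } k\in S_{\mathrm{on}}\cup S_{\mathrm{off}},$$ $$T_{\min}\le u_k\le T_{\max}\ \text{ for } k\in S_{\mathrm{on}}\cup S_{\mathrm{off}},$$ $$T^0=[T_{\mathrm{init}}(\Delta x),\dots,T_{\mathrm{init}}(M\Delta x)]^T.$$
   Context: Fixed data. Positive integers $N_f, M$ (number of time steps in a day and number of spatial nodes in the wall); a time step $\Delta t>0$ with $N_f\Delta t=24$; a wall width $L_{in}>0$ and space step $\Delta x = L_{in}/(M+1)$; positive physical constants $\alpha$ (thermal diffusivity), $R_e$ (thermal resistance of exterior walls), $C_{in}$ (thermal capacitance of interior walls); exterior temperatures $T_e^k\in\mathbb{R}$ for $k=0,\dots,N_f-1$; an initial wall temperature profile $T_{\mathrm{init}}:[0,L_{in}]\to\mathbb{R}$; interior temperature bounds $T_{\min},T_{\max}\in\mathbb{R}$; prices $p_{\mathrm{on}},p_{\mathrm{off}},p_d\in\mathbb{R}^+$ (on-peak, off-peak and demand prices). On-peak and off-peak times. Let $t_{\mathrm{on}}<t_{\mathrm{off}}$ be times of day in $[0,24]$ with $t_{\mathrm{on}}/\Delta t,\ t_{\mathrm{off}}/\Delta t\in\mathbb{N}$. For $k\in\{0,\dots,N_f-1\}$, $k\in S_{\mathrm{on}}$ if $k\Delta t\in[t_{\mathrm{on}},t_{\mathrm{off}}]$, and $k\in S_{\mathrm{off}}$ otherwise; thus $S_{\mathrm{on}}\cup S_{\mathrm{off}}=\{0,\dots,N_f-1\}$ is a disjoint union.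 Dynamics. $f:\mathbb{R}^M\times\mathbb{R}\to\mathbb{R}^M$ is $f(x,u) = (I+A\,\Delta t)x + B\,\Delta t\,u$, where $A\in\mathbb{R}^{M\times M}$ is $\frac{\alpha}{\Delta x^2}$ times the tridiagonal matrix with $-2$ on the diagonal and $1$ on the sub- and super-diagonals, and $B=\frac{\alpha}{\Delta x^2}(e_1+e_M)\in\mathbb{R}^M$, with $e_i$ the standard basis vectors. The state $T^k=(T^k_1,\dots,T^k_M)\in\mathbb{R}^M$ is the discretized wall temperature at time step $k$, and $u_k\in\mathbb{R}$ is the interior air temperature set-point. Power consumption. For $k\in\{0,\dots,N_f-1\}$ and $u,y\in\mathbb{R}$, $$g(k,u,y)=\frac{T_e^k-u}{R_e}+2\,C_{in}\,\frac{y-u}{\Delta x}.$$ Convention: a minimum over an empty set (an infeasible problem) is $+\infty$. *)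

(* Defs.v *)
From HB Require Import structures.
From mathcomp Require Import all_boot all_order all_algebra.
From mathcomp Require Import classical_sets reals constructive_ereal.

Set Implicit Arguments.
Unset Strict Implicit.
Unset Printing Implicit Defensive.

Import Order.TTheory GRing.Theory Num.Theory.
Local Open Scope classical_set_scope.
Local Open Scope ring_scope.

(* The minimum is attained, except that the minimum over the empty set is +oo;
   there is no minimum when a nonempty set does not attain its infimum. *)
Definition is_min (R : realType) (A : set (\bar R)) (v : \bar R) : Prop :=
  (A = set0 /\ v = +oo%E) \/ (A v /\ lbound A v).

Lemma is_min_unique (R : realType) (A : set (\bar R)) (v w : \bar R) :
  is_min A v -> is_min A w -> v = w.
Proof.
case=> [[A0 ->]|[Av lv]] [[B0 ->]|[Aw lw]] //.
- by rewrite A0 in Aw.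
- by rewrite B0 in Av.
- by apply/le_anti/andP; split; [apply: lv | apply: lw].
Qed.

(* Discretized heat equation in a wall with M interior nodes, over one day of
   N_f time steps. R^+ is read as the nonnegative reals (prices). [T_init] is a
   total function of which only the values on [0, L_in] are ever used. *)
Record control_data (R : realType) := ControlData {
  N_f : nat;
  M : nat;
  dt : R;
  L_in : R;
  alpha : R;
  R_e : R;
  C_in : R;
  T_e : 'I_N_f -> R;
  T_init : R -> R;
  T_min : R;
  T_max : R;
  p_on : R;
  p_off : R;
  p_d : R;
  t_on : R;
  t_off : R;
  N_f_gt0 : (0 < N_f)%N;
  M_gt0 : (0 < M)%N;
  dt_gt0 : 0 < dt;
  N_f_dt : N_f%:R * dt = 24;
  L_in_gt0 : 0 < L_in;
  alpha_gt0 : 0 < alpha;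
  R_e_gt0 : 0 < R_e;
  C_in_gt0 : 0 < C_in;
  p_on_ge0 : 0 <= p_on;
  p_off_ge0 : 0 <= p_off;
  p_d_ge0 : 0 <= p_d;
  t_on_ge0 : 0 <= t_on;
  t_on_lt_off : t_on < t_off;
  t_off_le24 : t_off <= 24;
  t_on_nat : t_on / dt \is a Num.nat;
  t_off_nat : t_off / dt \is a Num.nat
}.

Section Control.
Context {R : realType}.
Variable D : control_data R.

Definition dx : R := L_in D / (M D + 1)%:R.

Definition S_on : {set 'I_(N_f D)} :=
  [set k : 'I_(N_f D) | t_on D <= k%:R * dt D <= t_off D]%SET.
Definition S_off : {set 'I_(N_f D)} := (~: S_on)%SET.

Definition first_node : 'I_(M D) := Ordinal (M_gt0 D).
Definition last_node : 'I_(M D) := rev_ord first_node.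

Definition A : 'M[R]_(M D) :=
  (alpha D / dx ^+ 2) *:
    \matrix_(i, j) (if i == j then - 2
                    else if (i.+1 == j :> nat) || (j.+1 == i :> nat) then 1
                    else 0).

Definition B : 'cV[R]_(M D) :=
  (alpha D / dx ^+ 2) *: (delta_mx first_node 0 + delta_mx last_node 0).

Definition f (x : 'cV[R]_(M D)) (u : R) : 'cV[R]_(M D) :=
  (1%:M + dt D *: A) *m x + (dt D * u) *: B.

Definition g (k : 'I_(N_f D)) (u y : R) : R :=
  (T_e k - u) / R_e D + 2 * C_in D * ((y - u) / dx).

Definition T0 : 'cV[R]_(M D) := \col_(i < M D) T_init D (i.+1%:R * dx).

(* Time step k, and time step k + 1, among the N_f + 1 instants 0, ..., N_f. *)
Definition now (k : 'I_(N_f D)) : 'I_(N_f D).+1 := widen_ord (leqnSn _) k.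
Definition next (k : 'I_(N_f D)) : 'I_(N_f D).+1 := lift ord0 k.

Definition price (k : 'I_(N_f D)) : R :=
  if k \in S_on then p_on D else p_off D.

Definition W (gamma : R) (k : 'I_(N_f D)) (x : 'cV[R]_(M D)) : set R :=
  if k \in S_on
  then [set u | T_min D <= u <= T_max D /\ g k u (x first_node 0) <= gamma]
  else [set u | T_min D <= u <= T_max D].

(* The Bellman equation at index k = j - 1. *)
Definition bellman (gamma : R) (V : 'I_(N_f D).+1 -> 'cV[R]_(M D) -> \bar R) :=
  (forall x, V ord_max x = (p_d D / 30 * gamma)%:E) /\
  (forall (k : 'I_(N_f D)) x,
     is_min [set ((price k * g k u (x first_node 0) * dt D)%:E
                  + V (next k) (f x u))%E | u in W gamma k x]
            (V (now k) x)).

Definition feasible (gamma : R) (u : 'I_(N_f D) -> R)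
    (T : 'I_(N_f D).+1 -> 'cV[R]_(M D)) : Prop :=
  [/\ forall k, k \in S_on -> g k (u k) (T (now k) first_node 0) <= gamma,
      forall k, T (next k) = f (T (now k)) (u k),
      forall k, T_min D <= u k <= T_max D
    & T ord0 = T0].

Definition cost (gamma : R) (u : 'I_(N_f D) -> R)
    (T : 'I_(N_f D).+1 -> 'cV[R]_(M D)) : R :=
  (p_off D * (\sum_(k in S_off) g k (u k) (T (now k) first_node 0))
   + p_on D * (\sum_(k in S_on) g k (u k) (T (now k) first_node 0))) * dt D
  + p_d D / 30 * gamma.

Definition is_optimal_value (gamma : R) (J : \bar R) : Prop :=
  is_min [set c | exists u T, feasible gamma u T /\ c = (cost gamma u T)%:E] J.

End Control.

(* Main.v *)
Require Import Defs.
From HB Require Import structures.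
From mathcomp Require Import all_boot all_order all_algebra.
From mathcomp Require Import boolp classical_sets reals constructive_ereal.

Set Implicit Arguments.
Unset Strict Implicit.
Unset Printing Implicit Defensive.

Import Order.TTheory GRing.Theory Num.Theory.
Local Open Scope ring_scope.

(** This is the principle of optimality for deterministic finite-horizon
control. Demand enters the cost only through the constant [p_d / 30 * gamma],
because [gamma] is fixed: the cost is a sum of one stage cost per time step
plus a terminal constant ([cost_stages]), and feasibility is a constraint on
each step separately ([feasibleP]). So the problem can be solved one step at a
time.

On the one hand, along every feasible trajectory the Bellman equation gives
[V_k (T^k) <= stage cost of k + V_(k+1) (T^(k+1))]. These inequalities
telescope: [V_0 (T^0)] is at most the cost of the trajectory
([bellman_le_cost]). In particular no trajectory is feasible when
[V_0 (T^0)] is [+oo].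

On the other hand, the Bellman minimum is attained wherever the value function
differs from [+oo]. A choice of minimizers, one for each step and state, is a
feedback policy ([greedy_policy]). When [V_0 (T^0)] is not [+oo], the value
function stays below [+oo] along the trajectory of this policy, each
inequality above is an equality, and they telescope to the exact cost
([bellman_attained]). *)

(** The indices [j : 'I_n.+1] are the time instants, and each step [k : 'I_n]
leads from the instant [k] to the instant [k.+1]. *)
Lemma instant_ind (n : nat) (P : 'I_n.+1 -> Prop) :
    P ord0 ->
    (forall k : 'I_n, P (widen_ord (leqnSn n) k) -> P (lift ord0 k)) ->
  forall j, P j.
Proof.
move=> P0 PS [m]; elim: m => [|m IHm] ltm.
  by rewrite (_ : Ordinal ltm = ord0) //; apply: val_inj.
have ltmn : (m < n)%N by [].
rewrite (_ : Ordinal ltm = lift ord0 (Ordinal ltmn)); last exact: val_inj.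
apply: PS; rewrite (_ : widen_ord _ _ = Ordinal (ltnW ltm)) //.
exact: val_inj.
Qed.

Lemma sum_before_lift (V : nmodType) (n : nat) (c : 'I_n -> V) (k : 'I_n) :
  \sum_(i < n | (i < lift ord0 k)%N) c i = \sum_(i < n | (i < k)%N) c i + c k.
Proof.
rewrite lift0 (bigD1 k) //= addrC; congr (_ + _); apply: eq_bigl => i.
by rewrite ltnS ltn_neqAle andbC.
Qed.

Section BellmanPrinciple.
Context {R : realType}.
Variables (D : control_data R) (gamma : R).
Implicit Types (u : 'I_(N_f D) -> R) (T : 'I_(N_f D).+1 -> 'cV[R]_(M D)).

Definition stage_cost (k : 'I_(N_f D)) (x : 'cV[R]_(M D)) (v : R) : R :=
  price k * g k v (x (first_node D) 0) * dt D.

Lemma mem_W (k : 'I_(N_f D)) (x : 'cV[R]_(M D)) (v : R) :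
  W gamma k x v <->
  (T_min D <= v <= T_max D) /\
  (k \in S_on D -> g k v (x (first_node D) 0) <= gamma).
Proof.
rewrite /W; case: ifP => _; last by split=> [|[]].
by split=> [[? ?]|[? Hg]]; split=> //; apply: Hg.
Qed.

Lemma feasibleP u T :
  feasible gamma u T <->
  [/\ T ord0 = T0 D, forall k, T (Defs.next k) = f (T (now k)) (u k)
    & forall k, W gamma k (T (now k)) (u k)].
Proof.
split=> [[Hg HT Hu H0]|[H0 HT HW]].
  by split=> // k; apply/mem_W; split=> //; apply: Hg.
by split=> // k; have /mem_W[] := HW k.
Qed.

Lemma cost_stages u T :
  cost gamma u T =
  \sum_k stage_cost k (T (now k)) (u k) + p_d D / 30 * gamma.
Proof.
rewrite /cost; congr (_ + _).
rewrite [RHS](bigID (mem (S_on D))) /= [RHS]addrC mulrDl !mulr_sumr !mulr_suml.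
congr (_ + _); last first.
  by apply: eq_bigr => k kS; rewrite /stage_cost /price kS.
apply: eq_big => [k|k]; rewrite inE // => /negPf kS.
by rewrite /stage_cost /price kS.
Qed.

Section ValueFunction.
Variable V : 'I_(N_f D).+1 -> 'cV[R]_(M D) -> \bar R.
Hypothesis V_bellman : bellman gamma V.

Lemma bellman_le (k : 'I_(N_f D)) (x : 'cV[R]_(M D)) (v : R) :
  W gamma k x v ->
  (V (now k) x <= (stage_cost k x v)%:E + V (Defs.next k) (f x v))%E.
Proof.
move=> Wv; have [_ /(_ k x)] := V_bellman; set S := (X in is_min X _).
have Sv : S ((stage_cost k x v)%:E + V (Defs.next k) (f x v))%E by exists v.
by case=> [[S0 _]|[_ lb]]; [rewrite S0 in Sv | apply: lb].
Qed.

Lemma cost_to_end u T :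
  ((\sum_(i < N_f D | (i < @ord_max (N_f D))%N)
       stage_cost i (T (now i)) (u i))%:E + V ord_max (T ord_max))%E
  = (cost gamma u T)%:E.
Proof.
have [-> _] := V_bellman; rewrite -EFinD cost_stages.
by congr (_ + _)%:E; apply: eq_bigl => i; apply: ltn_ord.
Qed.

(** Telescoping of [bellman_le] along the trajectory. *)
Lemma bellman_le_cost u T :
  feasible gamma u T -> (V ord0 (T0 D) <= (cost gamma u T)%:E)%E.
Proof.
move=> /feasibleP[H0 HT HW]; rewrite -cost_to_end.
move: (@ord_max (N_f D)); elim/instant_ind => [|k IHk].
  by rewrite big_pred0 // add0e H0.
apply: (le_trans IHk); rewrite sum_before_lift EFinD -addeA HT.
by apply: leeD2l; apply: bellman_le.
Qed.

(** Where [V] is [+oo] there may be no admissible control at all, so the policy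
is constrained only at the other states. *)
Lemma greedy_policy :
  exists pi : 'I_(N_f D) -> 'cV[R]_(M D) -> R, forall k x,
    V (now k) x != +oo%E ->
    W gamma k x (pi k x) /\
    V (now k) x =
      ((stage_cost k x (pi k x))%:E + V (Defs.next k) (f x (pi k x)))%E.
Proof.
have pi_at k x : {v | V (now k) x != +oo%E ->
    W gamma k x v /\
    V (now k) x = ((stage_cost k x v)%:E + V (Defs.next k) (f x v))%E}.
  apply: cid; have [_ /(_ k x) [[_ ->]|[[v Wv Vv] _]]] := V_bellman.
    by exists 0; rewrite eqxx.
  by exists v => _; split; last exact: esym.
by exists (fun k x => sval (pi_at k x)) => k x; apply: svalP (pi_at k x).
Qed.

(** Indexing by [nat] allows a structural recursion; the control [0] serves
only beyond the horizon. *)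
Fixpoint closed_loop (pi : 'I_(N_f D) -> 'cV[R]_(M D) -> R) (n : nat) :=
  if n is m.+1 then
    let x := closed_loop pi m in f x (oapp (pi^~ x) 0 (insub m))
  else T0 D.

Lemma closed_loopS pi (k : 'I_(N_f D)) :
  closed_loop pi k.+1 = f (closed_loop pi k) (pi k (closed_loop pi k)).
Proof. by rewrite /= valK. Qed.

(** The trajectory is the closed loop of the greedy policy. That [V] is not
[+oo] must be carried along it: this is what makes the next greedy control
admissible, and it propagates because [V] at the next state is a summand of
[V] at the current one. *)
Lemma bellman_attained :
    V ord0 (T0 D) != +oo%E ->
  exists u T, feasible gamma u T /\ V ord0 (T0 D) = (cost gamma u T)%:E.
Proof.
move=> V0fin; have [pi piP] := greedy_policy.
pose T (j : 'I_(N_f D).+1) := closed_loop pi j.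
pose u k := pi k (T (now k)).
have TS k : T (Defs.next k) = f (T (now k)) (u k).
  by rewrite -closed_loopS /T /Defs.next lift0.
have Tfin j : V j (T j) != +oo%E.
  elim/instant_ind: j => [//|k Vk]; have [_ Vkeq] := piP _ _ Vk.
  apply: contra_neq Vk => VS.
  by rewrite Vkeq -/(u k) -TS VS.
exists u, T; split.
  by apply/feasibleP; split=> // k; have [] := piP _ _ (Tfin (now k)).
rewrite -cost_to_end; move: (@ord_max (N_f D)).
elim/instant_ind => [|k IHk]; first by rewrite big_pred0 // add0e.
rewrite IHk sum_before_lift EFinD -addeA; congr (_ + _)%E.
by have [_ ->] := piP _ _ (Tfin (now k)); rewrite TS.
Qed.

End ValueFunction.
End BellmanPrinciple.

Theorem theorem1 (R : realType) (D : control_data R) (gamma : R)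
    (gamma_ge0 : 0 <= gamma)
    (V : 'I_(N_f D).+1 -> 'cV[R]_(M D) -> \bar R)
    (V_gtNy : forall j x, (-oo < V j x)%E)
    (V_bellman : bellman gamma V) :
  is_optimal_value D gamma (V ord0 (T0 D)).
Proof.
have [V0|V0] := eqVneq (V ord0 (T0 D)) +oo%E; [left|right]; split=> //.
- rewrite -subset0 => c [u [T [/(bellman_le_cost V_bellman)]]].
  by rewrite V0 leye_eq.
- have [u [T [uT ->]]] := bellman_attained V_bellman V0.
  by exists u, T.
- by move=> c [u [T [uT ->]]]; apply: bellman_le_cost.
Qed.
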